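(* Let $\nu$ be a probability on $\mathbb T$. If $P_\nu$ is hyperbounded, then $\nu$ is continuous (atomless), and $$\sum_{n\in\mathbb Z,\ n\ne0}\frac{|\hat\nu(n)|^2}{|n|}<\infty.$$
   Context: $\mathbb T$ is the circle group, identified with $[-\pi,\pi)$, with normalized Haar (Lebesgue) measure $\mu$; $L^p=L^p(\mathbb T,\mu)$. For a probability $\nu$ on $\mathbb T$, $P_\nu f(x)=\nu*f(x)=\int_{\mathbb T}f(x-y)\,d\nu(y)$, which is a contraction of every $L^p$. $P_\nu$ is hyperbounded if it maps $L^p$ into $L^q$ for some $1<p<q\le\infty$. $\hat\nu(n)=\int e^{-inx}\,d\nu(x)$, $n\in\mathbb Z$. *)

(* Defs.v *)
From HB Require Import structures.
From mathcomp Require Import all_boot all_order all_algebra.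
From mathcomp Require Import all_classical all_reals all_analysis.
From mathcomp Require Import complex ring lra.

Set Implicit Arguments.
Unset Strict Implicit.
Unset Printing Implicit Defensive.

Import Order.TTheory GRing.Theory Num.Theory.
Import numFieldNormedType.Exports.

Local Open Scope classical_set_scope.
Local Open Scope ring_scope.

Notation normc := (@ComplexField.Normc.normc _).

Record circle (R : realType) := Circle {
  circle_val : R;
  _ : circle_val \in `[- pi, pi[ }.

HB.instance Definition _ (R : realType) := [isSub for @circle_val R].
HB.instance Definition _ (R : realType) := [Choice of circle R by <:].

Section circle_group.
Variable R : realType.
Implicit Types (s t : R) (x y z : circle R) (k : int).

(* the representative in [-pi, pi[ of t modulo 2 pi *)
Definition circ_mod t : R :=
  t - (pi *+ 2) * (Num.floor ((t + pi) / (pi *+ 2)))%:~R.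

Lemma pi2_gt0 : 0 < pi *+ 2 :> R.
Proof. by rewrite mulrn_wgt0// pi_gt0. Qed.

Lemma circ_mod_subproof t : circ_mod t \in `[- pi, pi[.
Proof.
have p0 := pi2_gt0; have := floor_itv ((t + pi) / (pi *+ 2)).
rewrite ler_pdivlMr// ltr_pdivrMr// intrD1 in_itv/= /circ_mod => /andP[h1 h2].
by apply/andP; split; lra.
Qed.

Definition to_circle t : circle R := Circle (circ_mod_subproof t).

Lemma circ_modP t : exists k, circ_mod t = t + (pi *+ 2) * k%:~R.
Proof.
by eexists (- Num.floor _); rewrite /circ_mod intrN mulrN.
Qed.

Lemma to_circleD2pi t k : to_circle (t + (pi *+ 2) * k%:~R) = to_circle t.
Proof.
apply/val_inj; rewrite /= /circ_mod.
have -> : (t + (pi *+ 2) * k%:~R + pi) / (pi *+ 2) =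
          (t + pi) / (pi *+ 2) + k%:~R.
  have p0 : pi *+ 2 != 0 :> R by exact: lt0r_neq0 pi2_gt0.
  by rewrite addrAC mulrDl [_ * k%:~R]mulrC mulfK.
by rewrite floorDrz ?intr_int// intrKfloor intrD; ring.
Qed.

Lemma to_circleK x : to_circle (val x) = x.
Proof.
apply/val_inj; rewrite /= /circ_mod.
have -> : Num.floor ((val x + pi) / (pi *+ 2)) = 0.
  apply: floor_def; have := valP x; rewrite in_itv/= => /andP[h1 h2].
  have p0 := pi2_gt0.
  by rewrite ler_pdivlMr// ltr_pdivrMr//; apply/andP; split; lra.
by rewrite mulr0 subr0.
Qed.

Definition circ_add x y := to_circle (val x + val y).
Definition circ_opp x := to_circle (- val x).

Lemma to_circleD s t : circ_add (to_circle s) (to_circle t) = to_circle (s + t).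
Proof.
rewrite /circ_add /=; have [m ->] := circ_modP s; have [n ->] := circ_modP t.
rewrite -[RHS](to_circleD2pi _ (m + n)); congr to_circle.
by rewrite intrD; ring.
Qed.

Fact circ_addA : associative circ_add.
Proof.
move=> x y z; rewrite -[x]to_circleK -[y]to_circleK -[z]to_circleK.
by rewrite !to_circleD addrA.
Qed.

Fact circ_addC : commutative circ_add.
Proof. by move=> x y; rewrite /circ_add addrC. Qed.

Fact circ_add0 : left_id (to_circle 0) circ_add.
Proof. by move=> x; rewrite -[x]to_circleK to_circleD add0r. Qed.

Fact circ_addN : left_inverse (to_circle 0) circ_opp circ_add.
Proof.
by move=> x; rewrite -{2}[x]to_circleK /circ_opp to_circleD addNr.
Qed.

HB.instance Definition _ := GRing.isZmodule.Build (circle R)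
  circ_addA circ_addC circ_add0 circ_addN.

HB.instance Definition _ := isPointed.Build (circle R) (to_circle 0).

Definition circ_measurable : set (set (circle R)) :=
  preimage_set_system setT val measurable.

Let circ_sigma : sigma_algebra setT circ_measurable.
Proof. exact/sigma_algebra_preimage/sigma_algebra_measurable. Qed.

Let circ_measurable0 : circ_measurable set0.
Proof. by case: circ_sigma. Qed.

Let circ_measurableC A : circ_measurable A -> circ_measurable (~` A).
Proof. by case: circ_sigma => _ + _; rewrite -setTD; exact. Qed.

Let circ_measurable_bigcup (F : (set (circle R))^nat) :
  (forall i, circ_measurable (F i)) -> circ_measurable (\bigcup_i F i).
Proof. by case: circ_sigma => _ _; exact. Qed.

HB.instance Definition _ := @isMeasurable.Build default_measure_display
  (circle R) circ_measurable circ_measurable0 circ_measurableC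
  circ_measurable_bigcup.

End circle_group.

Section haar.
Variable R : realType.

Lemma circ_imageE (B : set R) :
  (val : circle R -> R) @` (setT `&` val @^-1` B) = B `&` [set` `[- pi, pi[].
Proof.
apply/seteqP; split => [_ [x [_ Bx] <-]|t [Bt tI]].
  by split => //; exact: valP.
by exists (Circle tI).
Qed.

Lemma measurable_circ_image (A : set (circle R)) :
  measurable A -> measurable (val @` A : set R).
Proof. by case=> B mB <-; rewrite circ_imageE; exact: measurableI. Qed.

Definition haar (A : set (circle R)) : \bar R :=
  (((pi *+ 2)^-1)%:E * lebesgue_measure (val @` A : set R))%E.

Let haar0 : haar set0 = 0%E.
Proof. by rewrite /haar image_set0 measure0 mule0. Qed.

Let haar_ge0 A : (0 <= haar A)%E.
Proof.
by rewrite /haar mule_ge0// lee_fin invr_ge0 ltW// pi2_gt0.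
Qed.

Let haar_sigma_additive : semi_sigma_additive haar.
Proof.
move=> F mF tF mUF; rewrite /haar image_bigcup.
have h i : (0 <= lebesgue_measure (val @` F i : set R))%E by [].
rewrite (_ : (fun _ => _) = fun n => (((pi *+ 2)^-1)%:E *
    \sum_(0 <= i < n) lebesgue_measure (val @` F i : set R))%E); last first.
  by apply/funext => n; rewrite ge0_sume_distrr.
apply: cvgeZl => //.
apply: (@measure_semi_sigma_additive _ _ _ lebesgue_measure
  (fun n => val @` F n)).
- by move=> i; exact: measurable_circ_image (mF i).
- apply/trivIsetP => i j _ _ ij; apply/seteqP; split => // _ [[x Fx <-]].
  move=> [y Fy /val_inj yx]; rewrite yx in Fy.
  have FI : (F i `&` F j) x by [].
  by have /trivIsetP/(_ i j I I ij) FE := tF; rewrite FE in FI.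
- by rewrite -image_bigcup; exact: measurable_circ_image mUF.
Qed.

HB.instance Definition _ :=
  isMeasure.Build _ _ _ haar haar0 haar_ge0 haar_sigma_additive.

Let haar_setT : haar [set: circle R] = 1%E.
Proof.
rewrite /haar (_ : val @` _ = [set` `[- pi, pi[]); last first.
  by rewrite -[RHS]setTI -circ_imageE preimage_setT setTI.
rewrite lebesgue_measure_itv/= lte_fin.
have p0 := @pi2_gt0 R.
rewrite ifT; last by lra.
by rewrite opprK -EFinD -EFinM -mulr2n mulVf// gt_eqF.
Qed.

HB.instance Definition _ := Measure_isProbability.Build _ _ _ haar haar_setT.

End haar.
Arguments haar {R}.

Section complex_functions.
Context {d} {T : measurableType d} {R : realType}.

Definition cmeasurable (f : T -> R[i]) :=
  measurable_fun setT (fun x => complex.Re (f x)) /\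
  measurable_fun setT (fun x => complex.Im (f x)).

Definition cLfun (m : {measure set T -> \bar R}) (p : \bar R) :
    set (T -> R[i]) :=
  [set f | cmeasurable f /\ finite_norm m p (normc \o f)].

(* [Rintegral] is total: it is 0 when the integral is not finite. *)
Definition cintegral (m : {measure set T -> \bar R}) (f : T -> R[i]) : R[i] :=
  Complex (Rintegral m setT (fun x => complex.Re (f x)))
          (Rintegral m setT (fun x => complex.Im (f x))).

End complex_functions.

Section convolution.
Context {R : realType}.
Variable nu : probability (circle R) R.

(* For f in L^p, 1 <= p, the integral converges for haar-almost every x; the
   values at the remaining x do not affect membership in L^q. *)
Definition conv_op (f : circle R -> R[i]) : circle R -> R[i] :=
  fun x => cintegral nu (fun y => f (x - y)).

Definition hyperbounded :=
  exists p q : \bar R, [/\ (1 < p)%E, (p < q)%E &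
    forall f, cLfun haar p f -> cLfun haar q (conv_op f)].

Definition fourier_coef (n : int) : R[i] :=
  cintegral nu (fun x => Complex (cos (- n%:~R * val x))
                                 (sin (- n%:~R * val x))).

Definition atomless := forall x : circle R, nu [set x] = 0%E.

End convolution.

(* Main.v *)
(* Let 1/q < s < 1/p and let f behave like |t|^{-s} near 0, so that f is in L^p
   and P f in L^q. If M = 2^j, the Dirichlet kernel is at most
   min(M, C / |t|), hence |D_M(x0 - y)| <= C M^{1-s} f(x - y) whenever
   |x - x0| <= 1/M. Integrating over y gives int |D_M(x0 - y)| dnu(y) <=
   C M^{1-s} P f(x) for almost every x in an arc of length ~ 1/M around x0, and
   taking L^q norms over this arc yields, uniformly in x0,
       int |D_M(x0 - y)| dnu(y) <= C M^{1-s+1/q} = o(M).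
   As D_M(0) = M, nu has no atom; as the double integral of D_M(x - y) is the sum
   of |nu^(n)|^2 over 1 <= n <= M, the series converges by dyadic blocks. *)

Require Import Defs.
From mathcomp Require Import all_boot all_order all_algebra.
From mathcomp Require Import all_classical all_reals all_analysis.
From mathcomp Require Import measurable_realfun complex ring lra.
Import Order.TTheory GRing.Theory Num.Theory.
Import numFieldNormedType.Exports.
Set Implicit Arguments.
Unset Strict Implicit.
Unset Printing Implicit Defensive.
Local Open Scope classical_set_scope.
Local Open Scope ring_scope.

(** * Half-chords and the Dirichlet kernel *)

Section trigonometry.
Context {R : realType}.
Implicit Types t u v : R.

(** With v = u/2, the mean value theorem gives sin v >= v cos v, so sin u = 2 sin v cos v >= u cos^2
    v = (u/2)(1 + cos u) >= u/2. *)
Lemma sin_ge_half u : 0 <= u <= pi / 2 -> u / 2 <= sin u.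
Proof.
move=> /andP[u0 upi].
have mvt v : 0 < v <= pi / 4 -> v * cos v <= sin v.
  move=> /andP[v0 vpi].
  have p0 := pi_gt0 R.
  have [|c /[!in_itv]/= /andP[c0 cv]] := @MVT R sin cos 0 v v0.
    by apply: continuous_subspaceT; exact: continuous_sin.
  rewrite sin0 !subr0 => ->; rewrite mulrC ler_pM2r//.
  by rewrite ltW// ltr_cos ?in_itv//=; apply/andP; split; lra.
have [->|un0] := eqVneq u 0; first by rewrite mul0r sin0.
have {un0}u0 : 0 < u by rewrite lt_neqAle eq_sym un0.
have /mvt h : 0 < u / 2 <= pi / 4 by apply/andP; split; lra.
have cu0 : 0 <= cos u.
  by apply: cos_ge0_pihalf; apply/andP; split; have := pi_gt0 R; lra.
have -> : sin u = 2 * (cos (u / 2) * sin (u / 2)).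
  rewrite {1}(_ : u = (u / 2) *+ 2); last by rewrite mulr2n; lra.
  by rewrite sin_mulr2n mulr2n; lra.
have cE : 2 * cos (u / 2) ^+ 2 = 1 + cos u.
  rewrite [in RHS](_ : u = (u / 2) *+ 2); last by rewrite mulr2n; lra.
  by rewrite cos_mulr2n mulr2n; lra.
have c0 : 0 <= cos (u / 2).
  by apply: cos_ge0_pihalf; apply/andP; split; have := pi_gt0 R; lra.
apply: (@le_trans _ _ (2 * (cos (u / 2) * (u / 2 * cos (u / 2))))).
  have -> : 2 * (cos (u / 2) * (u / 2 * cos (u / 2))) =
      u / 2 * (2 * cos (u / 2) ^+ 2) by ring.
  rewrite cE ler_peMr//; lra.
by rewrite ler_pM2l// ler_wpM2l.
Qed.

Lemma norm_sin_le u : `|sin u| <= `|u|.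
Proof.
wlog u0 : u / 0 <= u => [H|].
  case: (leP 0 u) => [/H//|u0].
  by rewrite -[in X in sin X](opprK u) sinN normrN -(normrN u) H// oppr_ge0 ltW.
have [->|un0] := eqVneq u 0; first by rewrite sin0.
have {un0}u0' : 0 < u by rewrite lt_neqAle eq_sym un0.
have [|c _] := @MVT R sin cos 0 u u0'.
  by apply: continuous_subspaceT; exact: continuous_sin.
by rewrite sin0 !subr0 => ->; rewrite normrM ler_piMl// cos_max.
Qed.

Lemma norm_sinD_le u v : `|sin (u + v)| <= `|sin u| + `|sin v|.
Proof.
rewrite sinD (le_trans (ler_normD _ _))// !normrM lerD//.
  by rewrite ler_piMr// cos_max.
by rewrite ler_piMl// cos_max.
Qed.

(* [chord t] is half the length of the chord joining 1 to e^{it}. *)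
Definition chord t := `|sin (t / 2)|.

Lemma chord_ge0 t : 0 <= chord t. Proof. exact: normr_ge0. Qed.

Lemma chord_le1 t : chord t <= 1. Proof. exact: sin_max. Qed.

Lemma chordD_le u v : chord (u + v) <= chord u + chord v.
Proof. by rewrite /chord mulrDl norm_sinD_le. Qed.

Lemma chord_le t : chord t <= `|t| / 2.
Proof. by rewrite (le_trans (norm_sin_le _))// normrM [`|2^-1|]gtr0_norm. Qed.

Lemma chordD2pi t : chord (t + pi *+ 2) = chord t.
Proof.
rewrite /chord mulrDl (_ : pi *+ 2 / 2 = pi); last by rewrite mulr2n; lra.
by rewrite sinDpi normrN.
Qed.

Lemma chordDz2pi t (k : int) : chord (t + (pi *+ 2) * k%:~R) = chord t.
Proof.
have chordDn u (n : nat) : chord (u + (pi *+ 2) * n%:R) = chord u.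
  elim: n => [|n IH]; first by rewrite mulr0 addr0.
  by rewrite -natr1 mulrDr mulr1 addrA chordD2pi.
case: k => n; first exact: chordDn.
by rewrite NegzE mulrNz mulrN -[LHS](chordDn _ n.+1) subrK.
Qed.

(** Converse of [chord_le] up to a constant on one period. Together they make [chord] a periodic
    substitute for the distance to the multiples of 2 pi. *)
Lemma chord_ge t : `|t| <= pi -> `|t| <= chord t * 4.
Proof.
move=> tpi.
have -> : chord t = sin (`|t| / 2).
  rewrite /chord; case: (ger0P t) tpi => t0 tpi.
    by rewrite ger0_norm// sin_ge0_pi//; apply/andP; split; lra.
  rewrite -[in X in sin X](opprK t) mulNr sinN normrN ger0_norm//.
  by rewrite sin_ge0_pi//; apply/andP; split; lra.
have := @sin_ge_half (`|t| / 2); have := normr_ge0 t => t0.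
have : 0 <= `|t| / 2 <= pi / 2 by apply/andP; split; lra.
by move=> /[swap] /[apply]; lra.
Qed.

(** Only positive frequencies are kept: the classical Dirichlet kernel is 1 plus twice this sum, and
    the value at 0 is [M]. *)
Definition dirichlet (M : nat) t := \sum_(1 <= n < M.+1) cos (n%:R * t).

Lemma norm_dirichlet_le M t : `|dirichlet M t| <= M%:R.
Proof.
rewrite (le_trans (ler_norm_sum _ _ _))//.
rewrite (le_trans (ler_sum _ (fun i _ => cos_max _)))//.
by rewrite sumr_const_nat subn1.
Qed.

(** Telescoping: 2 sin(t/2) cos(n t) = sin((n + 1/2) t) - sin((n - 1/2) t). *)
Lemma dirichlet_sin M t :
  dirichlet M t * (2 * sin (t / 2)) = sin (M%:R * t + t / 2) - sin (t / 2).
Proof.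
rewrite /dirichlet; elim: M => [|M IH].
  by rewrite big_geq// !mul0r add0r subrr.
rewrite big_nat_recr//= mulrDl IH.
have -> : M%:R * t + t / 2 = M.+1%:R * t - t / 2 by rewrite -(natr1 M); lra.
by rewrite sinB sinD; ring.
Qed.

(** The decay C / |t| of the kernel; in terms of [chord] it holds for every real t, without
    reduction modulo 2 pi. *)
Lemma dirichlet_chord M t : `|dirichlet M t| * chord t <= 1.
Proof.
have : `|dirichlet M t * (2 * sin (t / 2))| <= 2.
  rewrite dirichlet_sin (le_trans (ler_normB _ _))//.
  by have := sin_max (M%:R * t + t / 2); have := sin_max (t / 2); lra.
by rewrite !normrM (gtr0_norm (_ : 0 < 2))// -/(chord t); lra.
Qed.

End trigonometry.

(** * Measurability on the circle and Haar measure of arcs *)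

Section arcs.
Context {R : realType}.
Implicit Types (x y : circle R) (t r : R).

Lemma measurable_circle_val : measurable_fun setT (@circle_val R).
Proof. by move=> _ B mB; rewrite setTI; exists B => //; rewrite setTI. Qed.

Lemma measurable_chord : measurable_fun setT (@chord R).
Proof.
apply: measurableT_comp => //.
apply: measurableT_comp; last exact: measurable_funM.
by apply: continuous_measurable_fun; exact: continuous_sin.
Qed.

Lemma measurable_dirichlet M : measurable_fun setT (@dirichlet R M).
Proof.
apply: measurable_sum => n; apply: measurableT_comp; last exact: measurable_funM.
by apply: continuous_measurable_fun; exact: continuous_cos.
Qed.

Lemma measurable_sub_val x :
  measurable_fun setT (fun y : circle R => circle_val x - circle_val y).
Proof. by apply: measurable_funB => //; exact: measurable_circle_val. Qed.

Lemma measurable_norm_dirichlet M x : measurable_fun setT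
  (fun y => (`|dirichlet M (circle_val x - circle_val y)|)%:E).
Proof.
apply/measurable_EFinP; apply: measurableT_comp => //.
exact: measurableT_comp (measurable_dirichlet M) (measurable_sub_val x).
Qed.

Lemma circle_valP x : - pi <= circle_val x < pi.
Proof. by have := valP x; rewrite in_itv. Qed.

(** Representatives subtract only modulo 2 pi, which [chord] does not see. Real differences can thus
    replace differences in the group. *)
Lemma chord_sub x y : chord (circle_val (x - y)) = chord (circle_val x - circle_val y).
Proof.
have cm t : chord (circ_mod t) = chord t.
  by have [k ->] := circ_modP t; rewrite chordDz2pi.
rewrite [LHS]cm; have [k] := circ_modP (- circle_val y).
by rewrite /= => ->; rewrite addrA chordDz2pi.
Qed.

Lemma measurable_circle_set1 x : measurable [set x].
Proof.
exists [set circle_val x] => //; rewrite setTI.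
by apply/seteqP; split => y /= => [/val_inj|->].
Qed.

Definition arc x r : set (circle R) :=
  [set y | chord (circle_val y - circle_val x) <= r].

Lemma measurable_arc x r : measurable (arc x r).
Proof.
rewrite (_ : arc x r =
    (fun y => chord (circle_val y - circle_val x)) @^-1` `]-oo, r]); last first.
  by apply/seteqP; split => y /=; rewrite in_itv.
rewrite -[X in measurable X]setTI.
suff : measurable_fun setT (fun y => chord (circle_val y - circle_val x)) by exact.
apply: measurableT_comp; first exact: measurable_chord.
by apply: measurable_funB => //; exact: measurable_circle_val.
Qed.

(** A difference of two representatives lies in (-2 pi, 2 pi), so by [chord_ge] a point of the arc
    is within 4r of x, x - 2 pi or x + 2 pi. This gives three intervals of length 8r; the factor
    1/(2 pi) <= 1 is dropped. *)
Lemma haar_arc_le x r : 0 <= r -> (haar (arc x r) <= (24 * r)%:E)%E.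
Proof.
move=> r0; have p1 : 1 < pi :> R by have := pi_ge2 R; lra.
pose I k : set R := `[circle_val x + k - 4 * r, circle_val x + k + 4 * r]%classic.
have lI k : lebesgue_measure (I k) = (8 * r)%:E.
  rewrite lebesgue_measure_itv/= lte_fin; case: ltP => h.
    by rewrite -EFinD; congr EFin; lra.
  by congr EFin; lra.
have sub : val @` arc x r `<=`
    I (- (pi *+ 2)) `|` I 0 `|` I (pi *+ 2).
  move=> _ [y /= xy <-]; have := circle_valP x; have := circle_valP y.
  move=> /andP[y1 y2] /andP[x1 x2].
  have ple d : chord d <= r -> `|d| <= pi -> `|d| <= 4 * r.
    by move=> dr /chord_ge; lra.
  rewrite /I /= !in_itv/=.
  have [dpi|dpi] := leP `|circle_val y - circle_val x| pi.
    by left; right; move: (ple _ xy dpi); rewrite ler_norml => /andP[h1 h2];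
      apply/andP; split; lra.
  move: dpi; rewrite ltr_normr => /orP[dpi|dpi].
    right; move: (ple (circle_val y - circle_val x + (pi *+ 2) * (-1)%:~R)).
    rewrite chordDz2pi => /(_ xy).
    rewrite mulrN1z mulrN mulr1 !ler_norml => h.
    have /h : - pi <= circle_val y - circle_val x - pi *+ 2 <= pi.
      by rewrite mulr2n; apply/andP; split; lra.
    by move=> /andP[h1 h2]; apply/andP; split; lra.
  left; left; move: (ple (circle_val y - circle_val x + (pi *+ 2))).
  rewrite chordD2pi => /(_ xy); rewrite !ler_norml => h.
  have /h : - pi <= circle_val y - circle_val x + pi *+ 2 <= pi.
    by rewrite mulr2n; apply/andP; split; lra.
  by move=> /andP[h1 h2]; apply/andP; split; lra.
have mI k : measurable (I k) by exact: measurable_itv.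
have mU2 (A B : set R) : measurable A -> measurable B ->
    (lebesgue_measure (A `|` B) <= lebesgue_measure A + lebesgue_measure B)%E.
  by move=> mA mB; exact: measureU2.
have : (lebesgue_measure (val @` arc x r : set R) <= (24 * r)%:E)%E.
  have m2 : measurable (I (- (pi *+ 2)) `|` I 0) by exact: measurableU.
  apply: (@le_trans _ _
    (lebesgue_measure (I (- (pi *+ 2)) `|` I 0 `|` I (pi *+ 2)))).
    apply: le_measure => //; rewrite inE; last exact: measurableU m2 (mI _).
    by apply: measurable_circ_image; exact: measurable_arc.
  apply: (le_trans (mU2 _ _ m2 (mI _))).
  apply: (@le_trans _ _ ((8 * r)%:E + (8 * r)%:E + (8 * r)%:E)%E).
    apply: leeD; last by rewrite lI.
    apply: (le_trans (mU2 _ _ (mI _) (mI _))).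
    by rewrite !lI.
  by rewrite -!EFinD lee_fin; lra.
move=> h; rewrite /haar.
apply: (@le_trans _ _ (((pi *+ 2)^-1)%:E * (24 * r)%:E)%E).
  by rewrite lee_wpmul2l// lee_fin invr_ge0 ltW// pi2_gt0.
rewrite -EFinM lee_fin ler_piMl//; first by lra.
by rewrite invf_le1 ?pi2_gt0// mulr2n; lra.
Qed.

Lemma haar_arc_ge x r : 0 <= r <= 1 ->
  (((pi *+ 2)^-1 * r)%:E <= haar (arc x r))%E.
Proof.
move=> /andP[r0 r1]; have p1 : 1 < pi :> R by have := pi_ge2 R; lra.
rewrite EFinM /haar; apply: lee_wpmul2l.
  by rewrite lee_fin invr_ge0 ltW// pi2_gt0.
have /andP[x1 x2] := circle_valP x.
(* An interval of length [r] with endpoint [x] inside [-pi, pi]: to the right of [x] if there is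
   room, otherwise to the left. *)
have [a [a1 a2 a3 a4]] : exists a, [/\ - pi <= a, a + r <= pi,
    a <= circle_val x & circle_val x <= a + r].
  have [h|h] := leP (circle_val x + r) pi; first by exists (circle_val x); split; lra.
  by exists (circle_val x - r); split; lra.
have -> : r%:E = lebesgue_measure (`[a, a + r[%classic : set R).
  rewrite lebesgue_measure_itv/= lte_fin; case: ltP => h.
    by rewrite -EFinD; congr EFin; lra.
  by congr EFin; lra.
apply: le_measure; rewrite ?inE.
- exact: measurable_itv.
- by apply: measurable_circ_image; exact: measurable_arc.
move=> t /=; rewrite in_itv/= => /andP[t1 t2].
have tI : t \in `[- pi, pi[ by rewrite in_itv/=; apply/andP; split; lra.
exists (Circle tI) => //; rewrite /arc /= (le_trans (chord_le _))//.
have : `|t - circle_val x| <= r by rewrite ler_norml; apply/andP; split; lra.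
by lra.
Qed.

End arcs.

(** * A dyadic model of the power singularity *)

Section peak.
Context {R : realType}.
Implicit Types (c la mu : R) (k j : nat).

(* For [1 < la], comparable to [c ^ (- log_2 la)] when [0 < c <= 1], and [+oo] when
   [c <= 0]. *)
Definition peak la c : \bar R :=
  (\sum_(k <oo) (la ^+ k * (c <= 2^-1 ^+ k)%R%:R)%:E)%E.

Lemma peak_ge0 la c : 0 <= la -> (0 <= peak la c)%E.
Proof.
by move=> la0; apply: nneseries_ge0 => k _ _; rewrite lee_fin mulr_ge0// exprn_ge0.
Qed.

Lemma peak_ge la c k : 0 <= la -> c <= 2^-1 ^+ k -> ((la ^+ k)%:E <= peak la c)%E.
Proof.
move=> la0 ck; rewrite /peak.
apply: (@le_trans _ _
  (\sum_(0 <= i < k.+1) (la ^+ i * (c <= 2^-1 ^+ i)%R%:R)%:E)%E).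
  rewrite big_nat_recr//= ck mulr1 leeDr// sume_ge0// => i _.
  by rewrite lee_fin mulr_ge0// exprn_ge0.
by apply: nneseries_lim_ge => i _; rewrite lee_fin mulr_ge0// exprn_ge0.
Qed.

Lemma measurable_peak la : 0 <= la -> measurable_fun setT (peak la).
Proof.
move=> la0; apply: ge0_emeasurable_sum => [k c _ _|k _].
  by rewrite lee_fin mulr_ge0// exprn_ge0.
apply/measurable_EFinP; apply: measurable_funM => //.
rewrite (_ : (fun c => _) = \1_`]-oo, 2^-1 ^+ k]%classic); last first.
  by apply/funext => c; rewrite indicE mem_setE/= in_itv/=.
exact: measurable_indic.
Qed.

(** If c <= 2^-k for all k, every term is la^k >= 1 and the series diverges; so some 2^-k lies below
    c. The least such index is positive because c <= 1, and its predecessor is the scale of c. *)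
Lemma peak_dyadic la c : 1 <= la -> 0 <= c <= 1 -> (peak la c < +oo)%E ->
  exists k, c <= 2^-1 ^+ k /\ 2^-1 ^+ k.+1 < c.
Proof.
move=> la1 /andP[c0 c1] cfin; have la0 : 0 <= la by rewrite (le_trans _ la1).
have [k ck] : exists k, 2^-1 ^+ k < c.
  apply: contrapT => /forallNP cN.
  suff cy : peak la c = +oo%E by rewrite cy ltxx in cfin.
  apply/eqP; rewrite -leye_eq /peak.
  rewrite -(_ : \sum_(0 <= k <oo) 1%:E = +oo)%E; last first.
    apply/cvg_lim => //; apply/cvgeyPge => M.
    near=> n; rewrite sumEFin sumr_const_nat subn0 lee_fin.
    near: n; exact: nbhs_infty_ger.
  apply: lee_nneseries => [k _ _|k _]; first by rewrite lee_fin.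
  have /negP := cN k; rewrite -leNgt => ->.
  by rewrite mulr1 lee_fin exprn_ege1.
have [[|n] nc nmin] := ex_minnP (ex_intro (fun k => 2^-1 ^+ k < c) k ck).
  by move: nc; rewrite expr0 ltNge c1.
exists n; split => //; rewrite leNgt; apply/negP => /nmin.
by rewrite ltnn.
Unshelve. all: by end_near. Qed.

(** With mu = 2^s, M = 2^j and c of order 2^-k, this is min(M, 1/c) <= C M^{1-s} c^{-s}. For j <= k
    use d <= 2^j = (2/mu)^j mu^j and mu >= 1; for k < j use that d is at most four times 2^k, and
    2/mu >= 1. *)
Lemma dyadic_interpolation (d c mu : R) j k : 1 <= mu <= 2 -> 0 <= d ->
  d <= 2 ^+ j -> d * c <= 2 -> 2^-1 ^+ k.+1 < c ->
  d <= 4 * (2 / mu) ^+ j * mu ^+ k.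
Proof.
move=> /andP[mu1 mu2] d0 dj dc kc; have mu0 : 0 < mu by rewrite (lt_le_trans _ mu1).
have [jk|kj] := leqP j k.
  apply: (le_trans dj); rewrite expr_div_n -mulrA -mulrA.
  rewrite -(subnK jk) exprD [mu ^+ (k - j) * _]mulrC mulKf; last first.
    by rewrite expf_neq0// gt_eqF.
  have : 1 <= mu ^+ (k - j) by rewrite exprn_ege1.
  have : 0 <= 2 ^+ j :> R by rewrite exprn_ge0.
  by nra.
have dk : d <= 4 * 2 ^+ k.
  have : d * 2^-1 ^+ k.+1 <= 2 by rewrite (le_trans _ dc)// ler_wpM2l// ltW.
  by rewrite exprVn ler_pdivrMr ?exprn_gt0// exprS; lra.
apply: (le_trans dk); rewrite -mulrA ler_pM2l//.
have -> : 2 ^+ k = (2 / mu) ^+ k * mu ^+ k by rewrite -exprMn divfK ?gt_eqF.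
rewrite ler_wpM2r ?exprn_ge0 ?(ltW mu0)//.
apply: ler_weXn2l; last exact: ltnW.
by rewrite ler_pdivlMr ?mul1r.
Qed.

(** Term by term: the k-th sublevel set is an arc of Haar measure at most 24 2^-k, which leaves a
    geometric series of ratio la/2 < 1. *)
Lemma integral_peak_chord la (y : circle R) : 0 <= la < 2 ->
  (\int[haar]_x peak la (chord (circle_val x - circle_val y)) <=
    (24 / (1 - la / 2))%:E)%E.
Proof.
move=> /andP[la0 la2].
have indE k : (fun x : circle R =>
    (chord (circle_val x - circle_val y) <= 2^-1 ^+ k)%R%:R : R) =
    \1_(arc y (2^-1 ^+ k)).
  by apply/funext => x; rewrite indicE mem_setE.
have mind k : measurable_fun setT (fun x : circle R =>
    (chord (circle_val x - circle_val y) <= 2^-1 ^+ k)%R%:R : R).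
  by rewrite indE; exact/measurable_indic/measurable_arc.
rewrite integral_nneseries//; last 2 first.
- by move=> k; apply/measurable_EFinP; apply: measurable_funM.
- by move=> k x _; rewrite lee_fin mulr_ge0// exprn_ge0.
have -> : (24 / (1 - la / 2))%:E =
    (\sum_(k <oo) (24 * (la / 2) ^+ k)%:E)%E.
  apply/esym/cvg_lim => //.
  rewrite (_ : (fun _ => _) = EFin \o series (geometric 24 (la / 2))); last first.
    by apply/funext => n; rewrite /= /series/= sumEFin.
  apply: cvg_EFin; first exact: nearW.
  by apply: cvg_geometric_series; rewrite ger0_norm ?divr_ge0// ltr_pdivrMr// mul1r.
apply: lee_nneseries => [k _ _|k _].
  by apply: integral_ge0 => x _; rewrite lee_fin mulr_ge0// exprn_ge0.
under eq_integral do rewrite EFinM.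
rewrite ge0_integralZl//; last 2 first.
- exact/measurable_EFinP.
- by rewrite lee_fin exprn_ge0.
rewrite (eq_integral (fun x => (\1_(arc y (2^-1 ^+ k)) x)%:E)); last first.
  by move=> x _; rewrite -indE.
rewrite integral_indic//; last exact: measurable_arc.
rewrite setIT; apply: (@le_trans _ _ ((la ^+ k)%:E * (24 * 2^-1 ^+ k)%:E)%E).
  rewrite lee_wpmul2l ?lee_fin ?exprn_ge0//.
  by apply: haar_arc_le; rewrite exprn_ge0.
by rewrite -EFinM lee_fin exprMn; lra.
Qed.

End peak.

(** * The test function and its convolution with the measure *)

Lemma fine_le_ge0 {R : realType} (e : \bar R) : (0 <= e)%E -> ((fine e)%:E <= e)%E.
Proof. by case: e => //= _; rewrite leey. Qed.

Lemma normc_real {R : realType} (a : R) : normc (Complex a 0) = `|a|.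
Proof. by rewrite /= expr0n addr0 sqrtr_sqr. Qed.

Lemma ler_norm_normc {R : realType} (z : R[i]) : `|complex.Re z| <= normc z.
Proof. by case: z => a b /=; rewrite -sqrtr_sqr ler_wsqrtr// lerDl sqr_ge0. Qed.

Section test_function.
Context {R : realType}.
Variables (la p : R).
Hypotheses (la1 : 1 <= la) (la2 : la < 2) (p1 : 1 <= p).

(** For la = 2^{sp} this models c^{-s}. [fine] turns the value +oo of [peak] into 0, so the function
    vanishes at the singularity. *)
Definition peak_root (c : R) : R := fine (peak la c) `^ p^-1.

Definition test_fun (x : circle R) : R[i] :=
  Complex (peak_root (chord (circle_val x))) 0.

Let la0 : 0 <= la. Proof. exact: le_trans la1. Qed.
Let p0 : 0 < p. Proof. exact: lt_le_trans p1. Qed.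

Lemma peak_root_ge0 c : 0 <= peak_root c. Proof. exact: powR_ge0. Qed.

Lemma measurable_peak_root : measurable_fun setT peak_root.
Proof.
apply: (measurableT_comp (measurable_powR _)).
by apply: measurableT_comp => //; exact: measurable_peak.
Qed.

(** The p-th power of [test_fun] is at most [peak la] of the chord, which is integrable because la <
    2. *)
Lemma cLfun_test_fun : cLfun haar p%:E test_fun.
Proof.
split; [split|].
- rewrite /=; apply: (measurableT_comp measurable_peak_root).
  apply: (measurableT_comp measurable_chord).
  exact: measurable_circle_val.
- exact: measurable_cst.
have absE x : (`|(EFin \o (normc \o test_fun)) x| =
    (peak_root (chord (circle_val x)))%:E)%E.
  by rewrite /comp normc_real abse_EFin normr_id ger0_norm// peak_root_ge0.
rewrite /finite_norm unlock; apply: poweR_lty.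
under eq_integral do rewrite absE poweR_EFin.
apply: (@le_lt_trans _ _ (\int[haar]_x
  peak la (chord (circle_val x - circle_val (0 : circle R)))%R)%E); last first.
  by apply: (le_lt_trans (integral_peak_chord _ _)); rewrite ?la0 ?ltry.
apply: ge0_le_integral => //.
- by move=> x _; rewrite lee_fin powR_ge0.
- apply/measurable_EFinP/(measurableT_comp (measurable_powR _)).
  apply: (measurableT_comp measurable_peak_root).
  apply: (measurableT_comp measurable_chord).
  exact: measurable_circle_val.
- apply: (measurableT_comp (measurable_peak la0)).
  apply: (measurableT_comp measurable_chord).
  by apply: measurable_funB => //; exact: measurable_circle_val.
move=> x _; rewrite -chord_sub subr0.
rewrite /peak_root -powRrM mulVf ?gt_eqF// powRr1 ?fine_ge0 ?peak_ge0//.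
by rewrite fine_le_ge0// peak_ge0.
Qed.

Variable nu : probability (circle R) R.

Let measurable_peak2 : measurable_fun setT
  (fun z : circle R * circle R =>
    peak la (chord (circle_val z.1 - circle_val z.2))).
Proof.
apply: (measurableT_comp (measurable_peak la0)).
apply: (measurableT_comp measurable_chord).
by apply: measurable_funB; apply: (measurableT_comp measurable_circle_val).
Qed.

Let measurable_peak1 x : measurable_fun setT
  (fun y : circle R => peak la (chord (circle_val x - circle_val y))).
Proof.
apply: (measurableT_comp (measurable_peak la0)).
apply: (measurableT_comp measurable_chord).
exact: measurable_sub_val.
Qed.

(** Tonelli: integrating in [x] first gives a bound uniform in [y], so the double integral is
    finite. At these [x] the integral defining [conv_op] of [test_fun] converges, and the default 0
    of [Rintegral] does not intervene. *)
Lemma ae_integral_peak_lty : {ae haar, forall x,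
  (\int[nu]_y peak la (chord (circle_val x - circle_val y)) < +oo)%E}.
Proof.
pose f (z : circle R * circle R) :=
  peak la (chord (circle_val z.1 - circle_val z.2)).
have f0 z : (0 <= f z)%E by exact: peak_ge0.
pose F x := (\int[nu]_y f (x, y))%E.
have F0 x : (0 <= F x)%E by apply: integral_ge0.
have iF : haar.-integrable setT F.
  apply/integrableP; split.
    exact: measurable_fun_fubini_tonelli_F.
  under eq_integral do rewrite gee0_abs//.
  rewrite /F fubini_tonelli//.
  apply: (@le_lt_trans _ _ (\int[nu]_y (24 / (1 - la / 2))%:E)%E).
    apply: ge0_le_integral => //.
    - by move=> y _; apply: integral_ge0.
    - exact: measurable_fun_fubini_tonelli_G.
    - by move=> y _; apply: integral_peak_chord; rewrite la0.
  rewrite integral_cst// [X in (_ * X)%E](_ : _ = 1%E); last exact: probability_setT.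
  by rewrite mule1 ltry.
have := integrable_ae measurableT iF.
apply: filterS => x /(_ I).
by rewrite ge0_fin_numE.
Qed.

Let mu := la `^ p^-1.

(** If c has scale 2^-k, then mu^k <= [peak_root c], because [peak la c] is at least la^k. The room
    2^-j in the hypothesis on [c] allows for a translation of the base point. *)
Lemma dirichlet_le_peak_root j (s c0 c : R) : 0 <= c <= 1 ->
  c <= chord s + 2^-1 ^+ j -> (peak la c < +oo)%E ->
  `|dirichlet (2 ^ j) s| <= 4 * (2 / mu) ^+ j * peak_root c.
Proof.
move=> c01 cc0 cfin.
have mu1 : 1 <= mu by rewrite -(powRr0 la) ler_powR// invr_ge0 ltW.
have mu2 : mu <= 2.
  by rewrite (le_trans _ (ltW la2))// -[leRHS](powRr1 la0) ler_powR// invf_le1.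
have [k [ck kc]] := peak_dyadic la1 c01 cfin.
have dj : `|dirichlet (2 ^ j) s| <= 2 ^+ j.
  by rewrite (le_trans (norm_dirichlet_le _ _))// natrX.
apply: (@le_trans _ _ (4 * (2 / mu) ^+ j * mu ^+ k)).
  apply: (dyadic_interpolation (c := c)) => //; first by rewrite mu1.
  (* With d the modulus of the kernel, d c <= d chord(s) + d 2^-j <= 1 + 1: decay bounds the first
     term, size the second. *)
  apply: (le_trans (ler_wpM2l (normr_ge0 _) cc0)).
  rewrite mulrDr (_ : 2 = 1 + 1)//; apply: lerD; first exact: dirichlet_chord.
  by rewrite exprVn ler_pdivrMr ?exprn_gt0// mul1r.
rewrite ler_wpM2l//.
  by rewrite mulr_ge0// exprn_ge0// divr_ge0// (le_trans _ mu1).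
rewrite /peak_root /mu -powR_mulrn ?powR_ge0// -powRrM mulrC powRrM powR_mulrn//.
apply: ge0_ler_powR; rewrite ?nnegrE ?invr_ge0 ?(ltW p0) ?exprn_ge0//.
  by rewrite fine_ge0// peak_ge0.
have /= := fine_le _ _ (peak_ge la0 ck).
by apply => //; rewrite ge0_fin_numE ?peak_ge0.
Qed.

(** The pointwise bound is integrated in [y]; by the triangle inequality for [chord], moving the
    base point from [x0] to [x] costs at most 2^-j. *)
Lemma dirichlet_conv_le j x0 x : arc x0 (2^-1 ^+ j) x ->
  (\int[nu]_y peak la (chord (circle_val x - circle_val y)) < +oo)%E ->
  (\int[nu]_y (`|dirichlet (2 ^ j) (circle_val x0 - circle_val y)|)%:E <=
    (4 * (2 / mu) ^+ j * normc (conv_op nu test_fun x))%:E)%E.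
Proof.
move=> xj fin.
set f := (fun y => peak la (chord (circle_val x - circle_val y))) in fin.
pose g y := peak_root (chord (circle_val x - circle_val y)).
have f0 y : (0 <= f y)%E by exact: peak_ge0.
have mf : measurable_fun setT f by exact: measurable_peak1.
have mg : measurable_fun setT g.
  apply: (measurableT_comp measurable_peak_root).
  apply: (measurableT_comp measurable_chord).
  exact: measurable_sub_val.
have g0 y : 0 <= g y by exact: peak_root_ge0.
have chord01 (t : R) : 0 <= chord t <= 1 by rewrite chord_ge0 chord_le1.
(* Where [peak] is finite it is at least 1, by its term k = 0, so its root does not exceed it; where
   it is infinite the root is 0. *)
have gf y : ((g y)%:E <= f y)%E.
  apply: (@le_trans _ _ (fine (f y))%:E); last exact: fine_le_ge0.
  rewrite lee_fin /g /peak_root -/(f y).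
  have [fy|fy] := ltP (f y) +oo%E; last first.
    by move: fy; rewrite leye_eq => /eqP ->; rewrite /= powR0// invr_neq0// gt_eqF.
  apply: ler1_powR; last by rewrite invf_le1.
  rewrite -lee_fin fineK ?ge0_fin_numE// -(expr0 la).
  by apply: peak_ge => //; rewrite expr0 chord_le1.
have K0 : 0 <= 4 * (2 / mu) ^+ j.
  by rewrite mulr_ge0// exprn_ge0// divr_ge0// powR_ge0.
have gfin : (\int[nu]_y (g y)%:E < +oo)%E.
  apply: le_lt_trans fin; apply: ge0_le_integral => //.
    by move=> y _; rewrite lee_fin.
  exact/measurable_EFinP.
apply: (@le_trans _ _ (\int[nu]_y ((4 * (2 / mu) ^+ j)%:E * (g y)%:E))%E).
  apply: ae_ge0_le_integral => //.
  - exact: measurable_norm_dirichlet.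
  - by move=> y _; rewrite -EFinM lee_fin mulr_ge0.
  - by apply/measurable_EFinP; exact: measurable_funM.
  (* The pointwise bound needs [peak] finite, which holds for nu-almost every [y] because its
     integral is finite. *)
  have fint : nu.-integrable setT f.
    by apply/integrableP; split => //; under eq_integral do rewrite gee0_abs//.
  have := integrable_ae measurableT fint.
  apply: filterS => y /(_ I); rewrite ge0_fin_numE// => fy _.
  rewrite -EFinM lee_fin; apply: dirichlet_le_peak_root => //.
  rewrite (_ : circle_val x - circle_val y = circle_val x - circle_val x0 +
    (circle_val x0 - circle_val y)); last by ring.
  by rewrite (le_trans (chordD_le _ _))// addrC lerD2l.
rewrite ge0_integralZl//; last 2 first.
- exact/measurable_EFinP.
- by move=> y _; rewrite lee_fin.
rewrite [leRHS]EFinM; apply: lee_wpmul2l; first by rewrite lee_fin.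
have -> : (\int[nu]_y (g y)%:E = (complex.Re (conv_op nu test_fun x))%:E)%E.
  rewrite /= /Rintegral fineK.
    by apply: eq_integral => y _; rewrite /g chord_sub.
  under eq_integral do rewrite chord_sub.
  rewrite ge0_fin_numE//; apply: integral_ge0 => y _.
  by rewrite lee_fin peak_root_ge0.
by rewrite lee_fin (le_trans (ler_norm _))// ler_norm_normc.
Qed.

End test_function.

(** * Uniform bound on the integrals of the Dirichlet kernel *)

Section powR_two.
Context {R : realType}.

Lemma powR2_lt1 (r : R) : r < 0 -> 2 `^ r < 1.
Proof.
move=> r0; rewrite lt_neqAle powR_eq1 pnatr_eq1/= ltNge ler0n/= lt_eqF//=.
by rewrite -[leRHS](powRr0 2) ler_powR ?ler1n// ltW.
Qed.

Lemma powR2_lt2 (r : R) : r < 1 -> 2 `^ r < 2.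
Proof.
move=> r1; rewrite -[ltRHS](powRr1 (ler0n _ 2)).
have -> : 2 `^ r = 2 `^ 1 * 2 `^ (r - 1) by rewrite -powRD ?subrKC// pnatr_eq0 implybT.
by rewrite gtr_pMr ?powR_gt0// powR2_lt1// subr_lt0.
Qed.

End powR_two.

Lemma measurable_normc d (T : measurableType d) (R : realType) (f : T -> R[i]) :
  cmeasurable f -> measurable_fun setT (normc \o f).
Proof.
move=> [mRe mIm].
rewrite (_ : _ \o _ = fun x => (complex.Re (f x) ^+ 2 + complex.Im (f x) ^+ 2) `^ 2^-1).
  apply: (measurableT_comp (measurable_powR _)).
  by apply: measurable_funD; exact: measurable_funX.
apply/funext => x /=; case: (f x) => a b /=.
by rewrite powR12_sqrt// addr_ge0 ?sqr_ge0.
Qed.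

Section dirichlet_bound.
Context {R : realType}.
Variable nu : probability (circle R) R.

(** The inequality p < q excludes p = +oo. If q = +oo, the exponent p + 1 serves, since L^oo is
    contained in L^{p+1} for a finite measure. *)
Lemma hyperbounded_finite : hyperbounded nu -> exists p q : R, [/\ 1 < p, p < q &
  forall f, cLfun haar p%:E f -> cLfun haar q%:E (conv_op nu f)].
Proof.
move=> [[p| |] [q [p1 pq H]]]; last 2 first.
- by rewrite ltNge leey in pq.
- by rewrite ltNge leNye in p1.
rewrite lte_fin in p1.
case: q pq H => [q|_|]//; first by rewrite lte_fin => pq H; exists p, q.
move=> H; exists p, (p + 1); split => //; first by rewrite ltrDl.
move=> f /H [mf ffin]; split => //.
have p11 : (1 <= (p + 1)%:E :> \bar R)%E by rewrite lee_fin; lra.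
have y1 : (1 <= +oo :> \bar R)%E by rewrite leey.
have haarT : haar [set: circle R] \is a fin_num by rewrite fin_num_measure.
have := @Lfun_subset _ _ R haar _ _ p11 y1 haarT (leey _) (normc \o conv_op nu f).
rewrite !inE => H'; have /H'/andP[_] : (normc \o conv_op nu f \in mfun) &&
    (normc \o conv_op nu f \in finLfun haar +oo%E).
  by apply/andP; split; rewrite inE//; exact: measurable_normc.
by rewrite inE.
Qed.

Lemma integral_dirichlet_le M x0 :
  (\int[nu]_y (`|dirichlet M (circle_val x0 - circle_val y)|)%:E <= M%:R%:E)%E.
Proof.
apply: (@le_trans _ _ (\int[nu]_y (M%:R : R)%:E)%E).
  apply: ge0_le_integral => //.
  - exact: measurable_norm_dirichlet.
  - by move=> y _; rewrite lee_fin norm_dirichlet_le.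
rewrite integral_cst// [X in (_ * X)%E](_ : _ = 1%E); last exact: probability_setT.
by rewrite mule1.
Qed.

Lemma hyperbounded_dirichlet : hyperbounded nu -> exists C rho : R,
  [/\ 0 <= C, 0 <= rho < 1 & forall j x0,
  (\int[nu]_y (`|dirichlet (2 ^ j) (circle_val x0 - circle_val y)|)%:E <=
    (C * 2 ^+ j * rho ^+ j)%:E)%E].
Proof.
move=> /hyperbounded_finite[p [q [p1 pq Hpq]]].
have p0 : 0 < p by lra.
have q0 : 0 < q by lra.
(* Midpoint of 1/q and 1/p: s p < 1 puts the test function in L^p, and 1/q < s makes the ratio rho =
   2^{1/q - s} less than 1. *)
pose s := (p^-1 + q^-1) / 2.
have qp : q^-1 < p^-1 by rewrite ltf_pV2.
have qi0 : 0 < q^-1 by rewrite invr_gt0.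
have sp : s * p < 1 by rewrite -ltr_pdivlMr// div1r /s; lra.
have sq : q^-1 - s < 0 by rewrite /s; lra.
have sp0 : 0 <= s * p by rewrite mulr_ge0 ?ltW// /s; lra.
pose la : R := 2 `^ (s * p).
have la1 : 1 <= la by rewrite -[leLHS](powRr0 2) ler_powR// ler1n.
have la2 : la < 2 by exact: powR2_lt2.
have p1' : 1 <= p by exact: ltW.
have muE : la `^ p^-1 = 2 `^ s by rewrite /la -powRrM mulfK// gt_eqF.
pose h := normc \o conv_op nu (test_fun la p).
have [mconv hfin] := Hpq _ (cLfun_test_fun la1 la2 p1').
have mh : measurable_fun setT h by exact: measurable_normc.
have h0 x : 0 <= h x by exact: le_trans (normr_ge0 _) (ler_norm_normc _).
have mhq : measurable_fun setT (fun x => (h x `^ q)%:E).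
  by apply/measurable_EFinP/(measurableT_comp (measurable_powR _)).
have Qfin : (\int[haar]_x (h x `^ q)%:E < +oo)%E.
  move: hfin; rewrite /finite_norm unlock => /lty_poweRy.
  rewrite invr_neq0 ?gt_eqF// => /(_ isT); apply: le_lt_trans.
  rewrite le_eqVlt; apply/orP; left; apply/eqP; apply: eq_integral => x _.
  by rewrite -/h [(EFin \o _) x]/= abse_EFin poweR_EFin ger0_norm.
pose Q := fine (\int[haar]_x (h x `^ q)%:E).
have QE : (\int[haar]_x (h x `^ q)%:E = Q%:E)%E.
  rewrite /Q fineK// ge0_fin_numE//; apply: integral_ge0 => x _.
  by rewrite lee_fin powR_ge0.
have Q0 : 0 <= Q.
  by rewrite -lee_fin -QE; apply: integral_ge0 => x _; rewrite lee_fin powR_ge0.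
(* The L^q norm of [h], times the q-th root of the 2 pi that comes from normalizing Haar measure. *)
pose W := (Q * (pi *+ 2)) `^ q^-1.
have ppos := pi2_gt0 R.
exists (4 * W), (2 `^ (q^-1 - s)); split.
- by rewrite mulr_ge0// powR_ge0.
- by rewrite powR_ge0 powR2_lt1.
move=> j x0; set A := (X in (X <= _)%E).
have A0 : (0 <= A)%E by apply: integral_ge0.
have Afin : A \is a fin_num.
  by rewrite ge0_fin_numE// (le_lt_trans (integral_dirichlet_le _ _))// ltry.
pose a := fine A; have AE : A = a%:E by rewrite /a fineK.
have a0 : 0 <= a by rewrite fine_ge0.
rewrite AE lee_fin.
pose B := arc x0 (2^-1 ^+ j); have mB : measurable B by exact: measurable_arc.
set mu := 2 `^ s in muE.
have mu0 : 0 < mu by rewrite powR_gt0.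
pose K := 4 * (2 / mu) ^+ j.
have K0 : 0 <= K by rewrite /K mulr_ge0// exprn_ge0// divr_ge0// ltW.
have ale : {ae haar, forall x, B x -> a <= K * h x}.
  apply: filterS (ae_integral_peak_lty la1 la2 nu) => x xfin Bx.
  by have := dirichlet_conv_le la1 la2 p1' Bx xfin; rewrite -/A AE lee_fin muE.
(* The almost everywhere bound a <= K h(x) on the arc [B], raised to the power q and integrated over
   [B]. *)
have : ((a `^ q)%:E * haar B <= (K `^ q * Q)%:E)%E.
  rewrite EFinM -QE -ge0_integralZl//; last 2 first.
  - by move=> x _; rewrite lee_fin powR_ge0.
  - by rewrite lee_fin powR_ge0.
  apply: (@le_trans _ _
    (\int[haar]_(x in B) ((K `^ q)%:E * (h x `^ q)%:E))%E); last first.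
    apply: ge0_subset_integral => //.
    - exact: measurable_funeM.
    - by move=> x _; rewrite -EFinM lee_fin mulr_ge0 ?powR_ge0.
  rewrite -integral_cst//; apply: ae_ge0_le_integral => //.
  - by move=> x _; rewrite lee_fin powR_ge0.
  - by move=> x _; rewrite -EFinM lee_fin mulr_ge0 ?powR_ge0.
  - by apply: measurable_funeM; exact: measurable_funTS.
  apply: filterS ale => x /[apply] ax.
  rewrite -EFinM lee_fin -powRM//; apply: ge0_ler_powR; rewrite ?nnegrE ?(ltW q0)//.
  by rewrite mulr_ge0.
have hB : (((pi *+ 2)^-1 * 2^-1 ^+ j)%:E <= haar B)%E.
  apply: haar_arc_ge; rewrite exprn_ge0 ?invr_ge0//= exprn_ile1 ?invr_ge0//.
  by rewrite invf_le1 ?ler1n.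
move=> /(le_trans (lee_wpmul2l _ hB)); rewrite lee_fin powR_ge0 => /(_ isT).
rewrite -EFinM lee_fin => aq.
have {}aq : a `^ q <= K `^ q * (Q * (pi *+ 2) * 2 ^+ j).
  move: aq; rewrite exprVn -invfM ler_pdivrMr ?mulr_gt0 ?exprn_gt0//.
  by rewrite !mulrA.
(* After q-th roots the measure of [B] contributes 2^{j/q}: a <= K W 2^{j/q}, and K = 4 (2/mu)^j
   with mu = 2^s turns this into 4 W 2^j rho^j. *)
have : (a `^ q) `^ q^-1 <= (K `^ q * (Q * (pi *+ 2) * 2 ^+ j)) `^ q^-1.
  by apply: ge0_ler_powR; rewrite ?nnegrE ?(ltW qi0) ?mulr_ge0 ?powR_ge0// ltW.
rewrite -powRrM mulfV ?gt_eqF// powRr1//.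
move=> /le_trans; apply.
rewrite powRM ?powR_ge0//; last by rewrite !mulr_ge0// ltW.
rewrite -powRrM mulfV ?gt_eqF// powRr1//.
rewrite powRM ?mulr_ge0 ?(ltW ppos) ?exprn_ge0// -/W.
have -> : (2 ^+ j) `^ q^-1 = (2 `^ q^-1) ^+ j :> R.
  by rewrite -(powR_mulrn j (ler0n R 2)) -(powR_mulrn j (powR_ge0 2 _)) powRAC.
rewrite powRB ?pnatr_eq0 ?implybT// -/mu /K !expr_div_n.
by rewrite le_eqVlt; apply/orP; left; apply/eqP; ring.
Qed.

End dirichlet_bound.

(** * Fourier coefficients and atoms through the Dirichlet kernel *)

Section bounded_integrals.
Context d (T : measurableType d) {R : realType}.
Variable P : probability T R.

Lemma integrable_bounded (f : T -> R) (K : R) :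
  measurable_fun setT f -> (forall x, `|f x| <= K) -> P.-integrable setT (EFin \o f).
Proof.
move=> mf fK; apply: measurable_bounded_integrable => //.
  by rewrite (le_lt_trans (probability_le1 _ _))// ltry.
exists K; split; first exact: num_real.
by move=> M KM x _ /=; rewrite (le_trans (fK x))// ltW.
Qed.

Lemma Rintegral_sum I (r : seq I) (f : I -> T -> R) :
  (forall i, P.-integrable setT (EFin \o f i)) ->
  Rintegral P setT (fun x => \sum_(i <- r) f i x) =
  \sum_(i <- r) Rintegral P setT (f i).
Proof.
move=> fi; rewrite /Rintegral.
under eq_integral do rewrite -sumEFin.
rewrite integral_sum// -sum_fine// => i _.
exact: integrable_fin_num (fi i).
Qed.

End bounded_integrals.

Section fourier.
Context {R : realType}.
Variable nu : probability (circle R) R.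

Let cosn (n : nat) (x : circle R) := cos (n%:R * circle_val x).
Let sinn (n : nat) (x : circle R) := sin (n%:R * circle_val x).
Let C n := Rintegral nu setT (cosn n).
Let S n := Rintegral nu setT (sinn n).

(** The squared modulus of the n-th Fourier coefficient, written with real integrals only. *)
Definition energy (n : nat) : R := C n ^+ 2 + S n ^+ 2.

Let measurable_cosn n : measurable_fun setT (cosn n).
Proof.
apply: measurableT_comp; first exact: continuous_measurable_fun (@continuous_cos R).
by apply: measurable_funM => //; exact: measurable_circle_val.
Qed.

Let measurable_sinn n : measurable_fun setT (sinn n).
Proof.
apply: measurableT_comp; first exact: continuous_measurable_fun (@continuous_sin R).
by apply: measurable_funM => //; exact: measurable_circle_val.
Qed.

Let integrable_cosn n : nu.-integrable setT (EFin \o cosn n).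
Proof. by apply: (integrable_bounded _ (K := 1)) => // x; exact: cos_max. Qed.

Let integrable_sinn n : nu.-integrable setT (EFin \o sinn n).
Proof. by apply: (integrable_bounded _ (K := 1)) => // x; exact: sin_max. Qed.

Let integrable_comb (a b : R) n :
  nu.-integrable setT (EFin \o (fun y => a * cosn n y + b * sinn n y)).
Proof.
apply: (integrable_bounded _ (K := `|a| + `|b|)).
  by apply: measurable_funD; apply: measurable_funM.
move=> x; rewrite (le_trans (ler_normD _ _))// !normrM lerD// ler_piMr//.
  exact: cos_max.
exact: sin_max.
Qed.

Let Rintegral_comb (a b : R) n :
  Rintegral nu setT (fun y => a * cosn n y + b * sinn n y) = a * C n + b * S n.
Proof.
rewrite RintegralD//.
- by rewrite !RintegralZl.
- have := integrable_comb a 0 n; congr (_.-integrable _ _).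
  by apply/funext => x /=; rewrite mul0r addr0.
- have := integrable_comb 0 b n; congr (_.-integrable _ _).
  by apply/funext => x /=; rewrite mul0r add0r.
Qed.

Lemma energy_ge0 n : 0 <= energy n. Proof. by rewrite addr_ge0 ?sqr_ge0. Qed.

(** The coefficients at n and -n are conjugate: the sign of the sine part disappears in the
    square. *)
Lemma normc_fourier_coef (k : int) : normc (fourier_coef nu k) ^+ 2 = energy `|k|%N.
Proof.
rewrite /fourier_coef /cintegral /= sqr_sqrtr ?addr_ge0 ?sqr_ge0// /energy.
case: k => n /=.
  congr (_ + _).
    by congr (_ ^+ 2); apply: eq_Rintegral => x _; rewrite mulNr cosN.
  rewrite -[RHS]sqrrN; congr (_ ^+ 2).
  rewrite -mulN1r -RintegralZl//; last exact: integrable_sinn.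
  by apply: eq_Rintegral => x _; rewrite mulNr sinN mulN1r.
by congr (_ + _); congr (_ ^+ 2); apply: eq_Rintegral => x _; rewrite NegzE mulrNz opprK.
Qed.

(** Since cos n(x - y) = cos nx cos ny + sin nx sin ny, the double integral of the kernel is the sum
    of the energies. The inner integral is at most b and nu has mass 1. *)
Lemma sum_energy_le M b : (forall x,
    (\int[nu]_y (`|dirichlet M (circle_val x - circle_val y)|)%:E <= b%:E)%E) ->
  \sum_(1 <= n < M.+1) energy n <= b.
Proof.
move=> Db.
pose phi x := \sum_(1 <= n < M.+1) (C n * cosn n x + S n * sinn n x).
have phiE x : phi x =
    Rintegral nu setT (fun y => dirichlet M (circle_val x - circle_val y)).
  transitivity (Rintegral nu setT (fun y =>
      \sum_(1 <= n < M.+1) (cosn n x * cosn n y + sinn n x * sinn n y))).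
    rewrite Rintegral_sum; last by move=> n; exact: integrable_comb.
    by apply: eq_bigr => n _; rewrite Rintegral_comb; congr (_ + _); rewrite mulrC.
  by apply: eq_Rintegral => y _; apply: eq_bigr => n _; rewrite mulrBr cosB.
have -> : \sum_(1 <= n < M.+1) energy n = Rintegral nu setT phi.
  rewrite Rintegral_sum; last by move=> n; exact: integrable_comb.
  by apply: eq_bigr => n _; rewrite Rintegral_comb.
have -> : b = Rintegral nu setT (cst b).
  by rewrite Rintegral_cst// [X in fine X](_ : _ = 1%E) ?mulr1//; exact: probability_setT.
apply: le_Rintegral => //.
- pose K := \sum_(1 <= n < M.+1) (`|C n| + `|S n|).
  apply: (integrable_bounded _ (K := K)).
    by apply: measurable_sum => n; apply: measurable_funD; apply: measurable_funM.
  move=> x; rewrite (le_trans (ler_norm_sum _ _ _))// ler_sum// => n _.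
  rewrite (le_trans (ler_normD _ _))// !normrM lerD// ler_piMr//.
    exact: cos_max.
  exact: sin_max.
- by apply: (integrable_bounded _ (K := `|b|)).
move=> x _; rewrite -/(phi x) phiE.
have mD : measurable_fun setT
    (fun y : circle R => dirichlet M (circle_val x - circle_val y)).
  apply: (measurableT_comp (measurable_dirichlet _)).
  exact: measurable_sub_val.
apply: (le_trans (ler_norm _)); apply: (le_trans (le_normr_Rintegral _ _)) => //.
  by apply: (integrable_bounded _ (K := M%:R)) => // y; exact: norm_dirichlet_le.
rewrite -lee_fin /Rintegral fineK; first exact: Db.
rewrite ge0_fin_numE; last by apply: integral_ge0 => y _; rewrite lee_fin.
by rewrite (le_lt_trans (Db x))// ltry.
Qed.

(** Restrict the integral to the singleton, where the kernel takes its value [M] at 0. *)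
Lemma atom_dirichlet_le M x : (nu [set x] * M%:R%:E <=
  \int[nu]_y (`|dirichlet M (circle_val x - circle_val y)|)%:E)%E.
Proof.
have mx := measurable_circle_set1 x.
have mD := measurable_norm_dirichlet M x.
apply: (@le_trans _ _ (\int[nu]_(y in [set x])
  (`|dirichlet M (circle_val x - circle_val y)|)%:E)%E); last first.
  by apply: ge0_subset_integral => //.
rewrite muleC -integral_cst// le_eqVlt; apply/orP; left; apply/eqP.
apply: eq_integral => y; rewrite inE => /= ->.
rewrite subrr /dirichlet; under eq_bigr do rewrite mulr0 cos0.
by rewrite sumr_const_nat subn1 /= ger0_norm.
Qed.

End fourier.

(** * From dyadic bounds to summability over the nonzero integers *)

(* Dyadic blocks: the weights n^{-1} are at most 2^{-j} on 2^j <= n < 2^{j+1}. *)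
Lemma dyadic_sum_le {R : realType} (w : nat -> R) (C rho : R) :
  (forall n, 0 <= w n) -> 0 <= C -> 0 <= rho < 1 ->
  (forall j, \sum_(1 <= n < (2 ^ j).+1) w n <= C * 2 ^+ j * rho ^+ j) ->
  forall N, \sum_(1 <= n < N) w n / n%:R <= 2 * C / (1 - rho).
Proof.
move=> w0 C0 /andP[rho0 rho1] wC N.
have wn0 n : 0 <= w n / n%:R by rewrite divr_ge0.
have r1 : 0 < 1 - rho by rewrite subr_gt0.
have block j : \sum_(2 ^ j <= n < 2 ^ j.+1) w n / n%:R <= 2 * C * rho ^+ j.+1.
  apply: (@le_trans _ _ (\sum_(2 ^ j <= n < 2 ^ j.+1) w n / 2 ^+ j)).
    rewrite big_nat_cond [leRHS]big_nat_cond; apply: ler_sum => n /andP[/andP[jn _] _].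
    rewrite ler_wpM2l// lef_pV2 ?posrE ?exprn_gt0// ?ltr0n.
      by rewrite -natrX ler_nat.
    by rewrite (leq_trans _ jn)// expn_gt0.
  rewrite -mulr_suml ler_pdivrMr ?exprn_gt0//.
  (* As w >= 0, the block is at most the partial sum up to 2^{j+1}; the hypothesis at j + 1, divided
     by 2^j, gives 2 C rho^{j+1}. *)
  apply: (@le_trans _ _ (\sum_(1 <= n < (2 ^ j.+1).+1) w n)).
    rewrite [leRHS](@big_cat_nat _ _ _ (2 ^ j)) ?expn_gt0//=; last first.
      by rewrite (leq_trans _ (leqnSn _))// leq_exp2l.
    rewrite (@big_cat_nat _ _ _ (2 ^ j.+1) _ (2 ^ j.+1).+1)//=; last by rewrite leq_exp2l.
    by rewrite addrCA lerDl addr_ge0// sumr_ge0.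
  by rewrite (le_trans (wC _))// [2 ^+ j.+1]exprS; lra.
have S j : (\sum_(1 <= n < 2 ^ j) w n / n%:R) * (1 - rho) <= 2 * C * (1 - rho ^+ j).
  elim: j => [|j IH]; first by rewrite big_geq// mul0r expr0 subrr mulr0.
  rewrite (@big_cat_nat _ _ _ (2 ^ j)) ?expn_gt0 ?leq_exp2l//= mulrDl.
  have := ler_wpM2r (ltW r1) (block j).
  (* Half the slack of the induction: 2C (rho^j - rho^{j+1}) exceeds 2C rho^{j+1} (1 - rho) by 2C
     rho^j (1 - rho)^2. *)
  have : 0 <= C * rho ^+ j * (1 - rho) ^+ 2 by rewrite !mulr_ge0 ?exprn_ge0 ?(ltW r1).
  by rewrite [rho ^+ j.+1]exprS expr2; move: IH; lra.
have NJ : (N <= 2 ^ N)%N by rewrite ltnW// ltn_expl.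
case: N NJ => [|N] NJ.
  by rewrite big_geq// divr_ge0 ?mulr_ge0// ltW.
rewrite ler_pdivlMr//; apply: (@le_trans _ _ (2 * C * (1 - rho ^+ N.+1))); last first.
  by rewrite ler_piMr ?mulr_ge0// gerBl exprn_ge0.
apply: le_trans (S N.+1); rewrite ler_wpM2r ?(ltW r1)//.
by rewrite [leRHS](@big_cat_nat _ _ _ N.+1)//= lerDl sumr_ge0.
Qed.

(** The nonzero integers are the disjoint ranges of n + 1 and [Negz] n = -(n + 1). The absolute
    value is n + 1 on both, so each half is at most K. *)
Lemma esum_nonzero_int {R : realType} (a : nat -> R) (K : R) :
  (forall n, 0 <= a n) ->
  (forall N, \sum_(1 <= n < N) a n <= K) ->
  (\esum_(k in [set k : int | k != 0%R]) (a `|k|%N)%:E < +oo)%E.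
Proof.
move=> a0 aK.
have K1 : (\sum_(n <oo) (a n.+1)%:E <= K%:E)%E.
  apply: lime_le; first by apply: is_cvg_nneseries => n _ _; rewrite lee_fin.
  apply: nearW => N; rewrite sumEFin lee_fin.
  by rewrite -(big_add1 _ _ 0 N.+1 xpredT).
have esumE (e : nat -> int) : injective e -> (forall n, `|e n|%N = n.+1) ->
    (\esum_(k in range e) (a `|k|%N)%:E <= K%:E)%E.
  move=> einj eE; rewrite esum_image; last by move=> m n _ _; exact: einj.
  under eq_esum do rewrite eE.
  by rewrite -nneseries_esumT// => n; rewrite lee_fin.
have -> : [set k : int | k != 0%R] = range (fun n => Posz n.+1) `|` range Negz.
  apply/seteqP; split => [[[|n]|n]//= _|_ [] [n _ <-]//].
    by left; exists n.
  by right; exists n.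
rewrite (esumID (range Negz)); last by move=> *; rewrite lee_fin.
apply: (@le_lt_trans _ _ (K%:E + K%:E)%E); last by rewrite -EFinD ltry.
apply: leeD.
  rewrite (_ : _ `&` _ = range Negz); last by rewrite setIC setKU.
  by apply: esumE => // m n [].
rewrite (_ : _ `&` _ = range (fun n => Posz n.+1)); first by apply: esumE => // m n [].
apply/seteqP; split => [k [[//|kN] /(_ kN)]//|_ [n _ <-]]; split; first by left; exists n.
by move=> [].
Qed.

Unset Implicit Arguments.

Theorem proposition6p7 (R : realType) (nu : probability (circle R) R) :
  hyperbounded nu ->
  atomless nu /\
  (\esum_(n in [set n : int | n != 0%R])
     (normc (fourier_coef nu n) ^+ 2 / `|n|%:~R)%:E < +oo)%E.
Proof.
move=> /hyperbounded_dirichlet[C [rho [C0 /andP[rho0 rho1] H]]]; split.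
  move=> x; apply/eqP; rewrite eq_le measure_ge0 andbT.
  have nufin : nu [set x] \is a fin_num.
    by apply: fin_num_measure; exact: measurable_circle_set1.
  pose e := fine (nu [set x]); have eE : nu [set x] = e%:E by rewrite /e fineK.
  rewrite eE lee_fin.
  (* At x the kernel integral is at least e 2^j and at most C 2^j rho^j; cancelling 2^j bounds the
     mass by a null sequence. *)
  have le_e j : e <= C * rho ^+ j.
    have := le_trans (atom_dirichlet_le nu (2 ^ j) x) (H j x).
    rewrite eE -EFinM lee_fin natrX mulrAC ler_pM2r// exprn_gt0//.
  have : (fun j => C * rho ^+ j) @ \oo --> (0 : R).
    by apply: cvg_geometric; rewrite ger0_norm.
  by move=> /cvgr_to_ge; apply; apply: nearW.
have := @esum_nonzero_int R (fun n => energy nu n / n%:R) (2 * C / (1 - rho)).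
have -> : (fun k : int => (energy nu `|k|%N / `|k|%N%:R)%:E) =
    (fun n : int => (normc (fourier_coef nu n) ^+ 2 / `|n|%:~R)%:E).
  by apply/funext => k; rewrite normc_fourier_coef -abszE -pmulrn.
apply.
  by move=> n; rewrite divr_ge0// energy_ge0.
apply: dyadic_sum_le => //; first exact: energy_ge0.
  by rewrite rho0.
by move=> j; apply: sum_energy_le => x; exact: H.
Qed.
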